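(* For any positive integers $t,s$ with $ts=n$, there is an $[nt,s]$-scheme for counting the number of connected components of an input graph on $n$ vertices.
   Context: Annotated streaming model (schemes): a space-bounded Verifier reads an input stream $\sigma$ (here the edges of an undirected graph on vertex set $[n]$); after the stream ends, an all-powerful Prover sends a help message to the Verifier as a stream. A scheme for a function $f$ consists of the Verifier's randomized streaming algorithm, the honest Prover's help function, and the Verifier's output procedure, outputting a value in $\mathrm{range}(f)\cup\{\bot\}$ ($\bot$ = reject), with perfect completeness (honest help makes the Verifier output $f(\sigma)$ with probability 1) and soundness error at most $1/3$ (for every $\sigma$ and every help message, the probability of outputting a value outside $\{f(\sigma),\bot\}$ is at most $1/3$). An $[h,v]$-scheme uses $\tilde{O}(h)$ bits of help and $\tilde{O}(v)$ bits of Verifier space, where $\tilde{O}$ hides factors polynomial in $\log n$. Here $f$ is the number of connected components of the graph. *)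

(* Defs.v *)
(* Model of annotated streaming schemes (non-uniform,
   space = log2 of the number of Verifier configurations, randomness stored). *)
From mathcomp Require Import all_boot.
Set Implicit Arguments. Unset Strict Implicit. Unset Printing Implicit Defensive.

Definition edge (n : nat) := ('I_n * 'I_n)%type.

Definition valid_stream (n : nat) (sigma : seq (edge n)) : bool :=
  all (fun p : edge n => p.1 != p.2) sigma &&
  uniq [seq [set p.1; p.2] | p <- sigma].

Definition stream_rel (n : nat) (sigma : seq (edge n)) : rel 'I_n :=
  fun u v => ((u, v) \in sigma) || ((v, u) \in sigma).

Definition num_cc (n : nat) (sigma : seq (edge n)) : nat :=
  n_comp (stream_rel sigma) (@predT 'I_n).

(* A scheme: Verifier (random seed drawn uniformly from [seed], working state in
   [state], update on input edges, update on help bits, output with None = reject)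
   and honest Prover help function. *)
Record scheme (n : nat) := Scheme {
  seed : finType;
  state : finType;
  v_init : seed -> state;
  v_upd : seed -> state -> edge n -> state;
  v_help : seed -> state -> bool -> state;
  v_out : seed -> state -> option nat;
  prover : seq (edge n) -> seq bool
}.

Definition run (n : nat) (V : scheme n) (r : seed V) (sigma : seq (edge n))
    (h : seq bool) : option nat :=
  v_out r (foldl (v_help r) (foldl (v_upd r) (v_init r) sigma) h).

Definition cc_scheme (n : nat) (V : scheme n) (hb vb : nat) : Prop :=
  [/\ 0 < #|seed V|,
      #|seed V| * #|state V| <= 2 ^ vb,
      (forall sigma, valid_stream sigma -> size (prover V sigma) <= hb),
      (forall sigma, valid_stream sigma -> forall r : seed V,
          run r sigma (prover V sigma) = Some (num_cc sigma)) &
      (forall sigma, valid_stream sigma -> forall h : seq bool,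
          3 * #|[pred r : seed V | match run r sigma h with
                                   | Some x => x != num_cc sigma
                                   | None => false end]| <= #|seed V|)].

Definition lg (n : nat) : nat := (trunc_log 2 n).+1.

(* Main.v *)
(* A prover exhibits a spanning forest (parent pointers) whose edges lie in the
   graph, and vertex labels that are constant along edges and take distinct
   values on the roots: the former bounds the number of components from above
   by the number of roots, the latter from below. Acyclicity is witnessed by
   depths: for formal X, the sum of X^(parent u, depth u) over the non-roots u
   must equal the sum of c_v X^(v, depth v + 1) over all v, with c_v the number
   of children of v. The other conditions amount to one inner product of
   length n^2, of the adjacency matrix with a matrix determined by the
   certificate, taking the right value. Splitting v = v1 s + y and giving
   (u, v1) the exponent x = u t + v1, that inner product is the coefficient of
   X^(nt-1) in P(X) = sum_y A_y(X) G_y(X), where A_y = sum A(u, v) X^x and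
   G_y = sum G(u, v) X^(nt-1-x); the coefficients of P are sent as help. The
   Verifier compares both polynomial identities at one random point r of F_p:
   it stores the s values A_y(r), and computes G_y(r) in one pass over the
   certificate since X^x splits into a power depending on u and one on v1. All
   its registers are additive in the tokens read. *)
Require Import Defs.
From mathcomp Require Import all_boot all_algebra zify ring.
Import GRing.Theory.
Set Implicit Arguments. Unset Strict Implicit. Unset Printing Implicit Defensive.

(** * Primes of polynomial size *)

(** By Legendre's formula the exponent is the sum over k of the differences
    [m.*2 %/ p ^ k - 2 * (m %/ p ^ k)]. Each is at most 1, and it vanishes once [p ^ k] exceeds
    [m.*2]. *)
Lemma logn_central_bin p m : prime p -> 0 < m ->
  p ^ logn p 'C(m.*2, m) <= m.*2.
Proof.
move=> p_pr m_gt0; have p_gt1 := prime_gt1 p_pr.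
have le_m2 : m <= m.*2 by lia.
have sum_ext : \sum_(1 <= k < m.+1) m %/ p ^ k = \sum_(1 <= k < m.*2.+1) m %/ p ^ k.
  rewrite [RHS](big_cat_nat (n := m.+1)) //= [X in _ = _ + X]big_nat_cond.
  rewrite [X in _ = _ + X]big1 ?addn0 // => k /andP[/andP[mk _] _].
  by rewrite divn_small // (ltn_trans mk) // ltn_expl.
have log_eq : logn p 'C(m.*2, m) + (\sum_(1 <= k < m.*2.+1) m %/ p ^ k).*2
            = \sum_(1 <= k < m.*2.+1) m.*2 %/ p ^ k.
  rewrite -logn_fact // -(bin_fact le_m2) lognM ?bin_gt0 ?muln_gt0 ?fact_gt0 //.
  by rewrite lognM ?fact_gt0 // (_ : m.*2 - m = m) ?logn_fact // ?sum_ext ?addnn //; lia.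
set l := trunc_log p m.*2.
have log_le : logn p 'C(m.*2, m) <= l.
  rewrite -(leq_add2r (\sum_(1 <= k < m.*2.+1) m %/ p ^ k).*2) log_eq.
  have -> : l = \sum_(1 <= k < m.*2.+1) (k <= l).
    rewrite (big_cat_nat (n := l.+1)) //=; last first.
      by rewrite ltnS -ltnS (leq_trans (ltn_expl l p_gt1)) // ltnW // ltnS trunc_logP ?double_gt0.
    rewrite [X in _ + X]big_nat_cond [X in _ + X]big1 => [|k]; last first.
      by rewrite andbT => /andP[lk _]; rewrite leqNgt lk.
    rewrite addn0 big_nat_cond (eq_bigr (fun=> 1)) => [|k /andP[/andP[_]]]; last first.
      by rewrite ltnS => ->.
    by rewrite -big_nat_cond sum_nat_const_nat; lia.
  rewrite -[(\sum_(_ <= _ < _) _).*2]addnn -!big_split /=; apply: leq_sum => k _.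
  case: (leqP k l) => [_|lt_l].
    have q_gt0 : 0 < p ^ k by rewrite expn_gt0 ltnW.
    rewrite -ltnS ltn_divLR //.
    have := divn_eq m (p ^ k); have := ltn_pmod m q_gt0; nia.
  rewrite divn_small // ltnNge; apply/negP => /(trunc_log_max p_gt1); lia.
by apply: leq_trans (leq_pexp2l _ log_le) (trunc_logP _ _); lia.
Qed.

(** Pascal's rule and symmetry make ['C(2m+2, m+1)] twice ['C(2m+1, m)], which is at least
    ['C(2m, m)]. *)
Lemma exp2_le_central_bin m : 2 ^ m <= 'C(m.*2, m).
Proof.
elim: m => // m IH; rewrite doubleS binS expnS mul2n -addnn.
apply: leq_add.
  apply: leq_trans IH _; rewrite -[X in _ <= X]bin_sub; last by lia.
  by rewrite (_ : _ - _ = m); [apply: leq_bin2l; lia | lia].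
by apply: leq_trans IH (leq_bin2l _ _).
Qed.

(* If no prime lay in ]2^a, 2m] then 'C(2m, m) would have at most 2^a prime
   factors, each with its power below 2m, contradicting 'C(2m, m) >= 2^m. *)
Lemma prime_between_exp2 a : exists2 p, prime p & 2 ^ a < p <= 2 ^ (a.*2 + 3).
Proof.
set m := 2 ^ (a.*2 + 2).
have m_gt0 : 0 < m by rewrite expn_gt0.
have m2E : m.*2 = 2 ^ (a.*2 + 3) by rewrite -mul2n -expnS; congr (2 ^ _); lia.
case: (pickP (fun i : 'I_(m.*2.+1) => prime i && (2 ^ a < i))) => [p /andP[p_pr p_gt]|no_p].
  by exists p => //; rewrite p_gt -m2E -ltnS /=.
(* Cancelling [2 ^ a] would leave [2 ^ (a + 2) <= 2a + 3], impossible since [a < 2 ^ a]. As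
   exponents of 2, the two sides become [2 ^ m] and [m.*2 ^ (2 ^ a)], which the factorization of the
   binomial compares. *)
suff : m <= (a.*2 + 3) * 2 ^ a.
  rewrite /m -addnn -addnA expnD mulnC leq_pmul2r ?expn_gt0 //.
  have : a < 2 ^ a by rewrite ltn_expl.
  rewrite expnD; lia.
rewrite -(leq_exp2l (m := 2)) //; apply: leq_trans (exp2_le_central_bin m) _.
have bin_gt : 0 < 'C(m.*2, m) by rewrite bin_gt0; lia.
have term_le q : q ^ logn q 'C(m.*2, m) <= m.*2.
  have [q_pr|q_npr] := boolP (prime q); first exact: logn_central_bin.
  by rewrite lognE (negPf q_npr) expn0; lia.
have term1 q : 2 ^ a < q -> q ^ logn q 'C(m.*2, m) = 1.
  move=> q_gt; have [q_pr|q_npr] := boolP (prime q); last by rewrite lognE (negPf q_npr).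
  have [q_le|q_big] := ltnP q m.*2.+1; first by have := no_p (Ordinal q_le); rewrite /= q_pr q_gt.
  case E: (logn _ _) => [|e] //; have := term_le q; rewrite E expnS.
  have : 0 < q ^ e by rewrite expn_gt0 prime_gt0.
  nia.
have a_le : (2 ^ a).+1 <= 'C(m.*2, m).+1.
  rewrite ltnS (leq_trans _ (exp2_le_central_bin m)) // leq_exp2l // /m.
  by apply: leq_trans (ltnW (ltn_expl a (ltnSn 1))) _; rewrite leq_exp2l //; lia.
rewrite -[X in X <= _](partnT bin_gt) /partn (big_cat_nat (n := (2 ^ a).+1)) //=.
rewrite [X in _ * X]big_nat_cond [X in _ * X]big1 ?muln1 => [|q]; last first.
  by move=> /andP[/andP[/term1]].
rewrite big_ltn_cond //= mul1n expnM -m2E.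
apply: leq_trans (leq_prod (E2 := fun=> m.*2) _) _ => //.
by rewrite prod_nat_const_nat subn1.
Qed.

(** * Certifying the number of components *)

Section Forest.
Variables (T : finType) (e : rel T).
Hypothesis e_sym : symmetric e.

Definition is_forest (par : T -> T) (d : T -> nat) :=
  forall u, par u != u -> e u (par u) /\ d u = (d (par u)).+1.

Let csym : connect_sym e := sym_connect_sym e_sym.

(** Following parents lowers [d], so every component contains a root of [par]. Labels are constant
    on components but differ between roots, so no component contains two. *)
Lemma n_comp_certificate (par : T -> T) (d : T -> nat) (lab : T -> T) :
    is_forest par d ->
    (forall u v, e u v -> lab u = lab v) ->
    (forall u, par u = u -> lab u = u) ->
  #|[pred u | par u == u]| = n_comp e (@predT T).
Proof.
move=> forest lab_e lab_root.
have lab_conn u v : connect e u v -> lab u = lab v.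
  by case/connectP=> q + ->; elim: q u => //= w q IH u /andP[/lab_e-> /IH].
have to_root u : exists2 z, par z = z & connect e u z.
  have [k le_k] := ubnP (d u); elim: k u le_k => // k IH u le_k.
  have [eq_u|ne_u] := eqVneq (par u) u; first by exists u.
  have [e_u d_u] := forest u ne_u.
  have [|z z_root conn_z] := IH (par u); first by rewrite -ltnS -d_u.
  by exists z => //; apply: connect_trans (connect1 e_u) conn_z.
rewrite /n_comp_mem -(card_in_image (f := fingraph.root e)); last first.
  move=> u v /eqP u_root /eqP v_root /(fingraph.rootP csym) /lab_conn.
  by rewrite !lab_root.
apply: eq_card => x; rewrite !inE andbT; apply/imageP/eqP => [[z _ ->]|x_root].
  exact: root_root.
have [z z_root conn_z] := to_root x.
exists z; first exact/eqP.
by rewrite -(fingraph.rootP csym conn_z) x_root.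
Qed.

(** Breadth-first forest: [d] is the distance to the canonical representative of the component, and
    [par] picks a neighbour one step closer. A shortest path repeats no vertex, hence the bound on
    [d]. *)
Lemma ex_spanning_forest : exists par d,
  [/\ is_forest par d, forall u, par u = u -> fingraph.root e u = u
    & forall u, d u < #|T|].
Proof.
pose reach u k := [exists q : k.-tuple T, path e u q && (last u q == fingraph.root e u)].
have reach_ex u : exists k, reach u k && (k < #|T|).
  have /connectP[q e_q] := connect_root e u.
  case/shortenP: e_q => q' e_q' uniq_q' _ last_q'.
  exists (size q'); apply/andP; split.
    by apply/existsP; exists (in_tuple q'); rewrite e_q' last_q' /=.
  by rewrite -[_ < _]/(size (u :: q') <= _) -(card_uniqP uniq_q') max_card.
pose d u := ex_minn (reach_ex u).
have d_min u k : reach u k -> d u <= k.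
  rewrite /d; case: ex_minnP => m /andP[_ m_lt] m_min r_k.
  by case: (ltnP k #|T|) => [k_lt|]; [apply: m_min; rewrite r_k | lia].
have d_reach u : reach u (d u) by rewrite /d; case: ex_minnP => m /andP[].
have d_lt u : d u < #|T| by rewrite /d; case: ex_minnP => m /andP[].
have d_step u v : e u v -> d u <= (d v).+1.
  move=> e_uv; have /existsP[q /andP[e_q /eqP last_q]] := d_reach v.
  apply: d_min; apply/existsP; exists [tuple of v :: q].
  rewrite /= e_uv e_q last_q; apply/eqP; apply/esym/(fingraph.rootP csym)/connect1.
  exact: e_uv.
have d_ex u : u != fingraph.root e u -> exists v, e u v && (d u == (d v).+1).
  move=> u_nroot; have := d_reach u; case E: (d u) => [|k] /existsP[q].
    by rewrite (tuple0 q) /= (negPf u_nroot).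
  case/tupleP: q => v q /= /andP[/andP[e_uv e_q] last_q].
  have root_v : fingraph.root e v = fingraph.root e u.
    by apply/esym/(fingraph.rootP csym)/connect1.
  exists v; rewrite e_uv eqSS eqn_leq -ltnS -E d_step //= d_min //.
  by apply/existsP; exists q; rewrite e_q root_v.
pose par u := odflt u [pick v | e u v && (d u == (d v).+1)].
exists par, d; split=> // u; rewrite /par; case: pickP => [v /andP[e_uv /eqP d_u]|no_v] //=.
- by rewrite eqxx.
- by move=> v_u; move: d_u; rewrite v_u; lia.
move=> _; apply/eqP; rewrite eq_sym; apply: contraT => /d_ex[v].
by rewrite no_v.
Qed.

End Forest.

(** * Adjacency as edge multiplicity in the stream *)

Section Multiplicity.
Variable n : nat.
Implicit Types (sigma : seq (edge n)) (u v : 'I_n).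

Definition adj_count sigma u v := count (pred2 (u, v) (v, u)) sigma.

Lemma stream_rel_sym sigma : symmetric (stream_rel sigma).
Proof. by move=> u v; rewrite /stream_rel orbC. Qed.

Lemma adj_count_gt0 sigma u v : (0 < adj_count sigma u v) = stream_rel sigma u v.
Proof.
rewrite -has_count; apply/hasP/orP.
  by case=> x x_in /orP[]/eqP <-; [left | right].
by case=> x_in; [exists (u, v) | exists (v, u)]; rewrite //= eqxx ?orbT.
Qed.

Lemma adj_count_le1 sigma u v : valid_stream sigma -> adj_count sigma u v <= 1.
Proof.
case/andP=> _; elim: sigma => //= x sigma IH /andP[x_notin /IH le1].
rewrite /adj_count /=; case x_uv: (_ || _); last by rewrite add0n.
rewrite -/(adj_count sigma u v) -[_ <= 1]/(adj_count sigma u v <= 0) leqNgt.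
apply: contra x_notin; rewrite -has_count => /hasP[y y_in y_uv].
apply/mapP; exists y => //.
by move: x_uv y_uv => /orP[]/eqP-> /orP[]/eqP->; rewrite //= setUC.
Qed.

End Multiplicity.

(** * Schemes from additive sketches *)

Section BitEncoding.
Variables (T : finType) (b : nat) (t0 : T).
Hypotheses (b_gt0 : 0 < b) (T_le : #|T| <= 2 ^ b).

Lemma card_bit_tuple : #|{: b.-tuple bool}| = 2 ^ b.
Proof. by rewrite card_tuple card_bool. Qed.

Let rank_le : #|T| <= #|{: b.-tuple bool}|.
Proof. by rewrite card_bit_tuple. Qed.

Definition enc (x : T) : b.-tuple bool := enum_val (widen_ord rank_le (enum_rank x)).

(** A dishonest block may encode no token; it is then read as [t0]. *)
Definition dec (l : seq bool) : T := odflt t0 [pick x | enc x == l :> seq bool].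

Lemma encK x : dec (enc x) = x.
Proof.
rewrite /dec; case: pickP => [y /eqP /val_inj /enum_val_inj /(congr1 val) /= /ord_inj|].
  by move/enum_rank_inj.
by move/(_ x); rewrite eqxx.
Qed.

Section Step.
Variables (S : Type) (step : S -> T -> S).

Definition bit_step (st : S * {bseq b of bool}) (x : bool) : S * {bseq b of bool} :=
  let l := rcons st.2 x in
  if size l == b then (step st.1 (dec l), [bseq]) else (st.1, insub_bseq b l).

End Step.

(** The complete blocks decoded as tokens, together with the unfinished last block. Every bitwise
    run factors through it. *)
Definition parse : seq bool -> seq T * {bseq b of bool} :=
  foldl (bit_step (@rcons T)) ([::], [bseq]).

Lemma foldl_bit_step S (step : S -> T -> S) s h :
  foldl (bit_step step) (s, [bseq]) h = (foldl step s (parse h).1, (parse h).2).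
Proof.
elim/last_ind: h => // h x IH; rewrite /parse !foldl_rcons IH -/parse.
by rewrite /bit_step /=; case: ifP => // _; rewrite foldl_rcons.
Qed.

Lemma parse_enc w : parse (flatten [seq val (enc x) | x <- w]) = (w, [bseq]).
Proof.
elim/last_ind: w => // w x IH.
rewrite map_rcons flatten_rcons /parse foldl_cat -/parse IH.
(* Generalization to a block read halfway: [l1] is already buffered, [l2] is still to come. *)
suff buf (l1 l2 : seq bool) (l : {bseq b of bool}) : l = l1 :> seq bool ->
    0 < size l2 -> size (l1 ++ l2) = b ->
    foldl (bit_step (@rcons T)) (w, l) l2 = (rcons w (dec (l1 ++ l2)), [bseq]).
  by rewrite (buf [::]) ?size_tuple //= encK.
elim: l2 l1 l => // y l2 IH2 l1 l l_l1 _ size_l /=.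
rewrite {2}/bit_step /= l_l1; move: size_l; rewrite -cat_rcons size_cat.
case: l2 IH2 => [|z l2] IH2 size_l.
  by rewrite cats0; case: ifP => // /eqP; move: size_l; rewrite /=; lia.
case: ifP => [/eqP|_]; first by rewrite /= in size_l; lia.
apply: IH2 => //; last by rewrite size_cat.
by rewrite insubdK // -topredE /= /in_mem /=; lia.
Qed.

Lemma size_enc w : size (flatten [seq val (enc x) | x <- w]) = size w * b.
Proof.
by elim: w => //= x w IH; rewrite size_cat size_tuple IH mulSn.
Qed.

End BitEncoding.

(** Bit strings of length at most [hb] form a finite type, so an accepted help message can be found
    by search. This turns mere existence of good help into a prover function. *)
Lemma scheme_with_prover n (seed state : finType) (init : seed -> state)
    (upd : seed -> state -> edge n -> state) (help : seed -> state -> bool -> state)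
    (out : seed -> state -> option nat) (hb vb : nat) :
    let V := Scheme init upd help out in
    let result r sigma h := run (V := V (fun=> [::])) r sigma h in
    0 < #|seed| -> #|seed| * #|state| <= 2 ^ vb ->
    (forall sigma, valid_stream sigma -> exists2 h : seq bool, size h <= hb &
       forall r, result r sigma h = Some (num_cc sigma)) ->
    (forall sigma, valid_stream sigma -> forall h : seq bool,
       3 * #|[pred r | match result r sigma h with
                       | Some x => x != num_cc sigma
                       | None => false end]| <= #|seed|) ->
  exists V : scheme n, cc_scheme V hb vb.
Proof.
move=> V result seed_gt0 space complete sound.
pose good sigma (h : {bseq hb of bool}) :=
  [forall r, result r sigma h == Some (num_cc sigma)].
pose honest sigma : seq bool := if [pick h | good sigma h] is Some h then h else [::].
exists (Scheme init upd help out honest); split=> // sigma sigma_ok; rewrite /= /honest.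
  by case: pickP => [h _|//]; exact: size_bseq.
case: pickP => [h /forallP good_h r|no_h]; first exact/eqP/good_h.
have [h size_h h_ok] := complete sigma sigma_ok.
have /negP[] := negbT (no_h (Bseq size_h)).
by apply/forallP => r; apply/eqP/h_ok.
Qed.

Section Sketch.
Variables (n M b : nat) (R J T : finType) (F : finZmodType) (t0 : T).
Variables (alpha : R -> edge n -> J -> F) (beta : R -> nat -> T -> J -> F).
Variable out : R -> (J -> F) -> option nat.
Local Open Scope ring_scope.

(* Final contents of the registers of a Verifier that adds a contribution of each
   token to them, independently of their current contents. *)
Definition sketch r (sigma : seq (edge n)) (w : seq T) : {ffun J -> F} :=
  [ffun k => \sum_(e <- sigma) alpha r e k + \sum_(i < M) beta r i (nth t0 w i) k].

(** The counter saturates at [M.+1], so that help with too many tokens stays distinguishable from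
    help with exactly [M]. *)
Let token_step r (st : 'I_M.+2 * {ffun J -> F}) x : 'I_M.+2 * {ffun J -> F} :=
  (inord (minn st.1.+1 M.+1), [ffun k => st.2 k + beta r st.1 x k]).

Let foldl_token_step r (f : {ffun J -> F}) w :
  let st := foldl (token_step r) (ord0, f) w in
  st.1 = minn (size w) M.+1 :> nat /\
  ((size w <= M)%N -> st.2 = [ffun k => f k + \sum_(i < size w) beta r i (nth t0 w i) k]).
Proof.
elim/last_ind: w => [|w x [IH1 IH2]] /=.
  split=> [|_]; first by rewrite min0n.
  by apply/ffunP => k; rewrite !ffunE big_ord0 addr0.
rewrite foldl_rcons size_rcons /= inordK ?IH1; last by lia.
split=> [|w_lt]; first by lia.
apply/ffunP => k; rewrite IH2 ?ffunE; last by lia.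
rewrite big_ord_recr /= nth_rcons ltnn eqxx addrA (minn_idPl _); last by lia.
by congr (_ + _ + _); apply: eq_bigr => i _; rewrite nth_rcons ltn_ord.
Qed.

Let stream_step r (f : {ffun J -> F}) e : {ffun J -> F} :=
  [ffun k => f k + alpha r e k].

Let foldl_stream r (f : {ffun J -> F}) sigma :
  foldl (stream_step r) f sigma =
  [ffun k => f k + \sum_(e <- sigma) alpha r e k].
Proof.
elim: sigma f => [|e sigma IH] f /=.
  by apply/ffunP => k; rewrite ffunE big_nil addr0.
by rewrite IH; apply/ffunP => k; rewrite !ffunE big_cons addrA.
Qed.

Hypotheses (R_gt0 : (0 < #|R|)%N) (b_gt0 : (0 < b)%N) (T_le : (#|T| <= 2 ^ b)%N).
Hypothesis complete : forall sigma, valid_stream sigma ->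
  exists2 w, size w = M & forall r, out r (sketch r sigma w) = Some (num_cc sigma).
Hypothesis sound : forall sigma, valid_stream sigma -> forall w,
  (3 * #|[pred r | match out r (sketch r sigma w) with
                   | Some x => x != num_cc sigma
                   | None => false end]| <= #|R|)%N.

(** Help that does not parse into exactly [M] tokens is rejected, so soundness over token lists
    suffices. The state consists of the counter, the registers and a partial block; there are fewer
    than [2 ^ b.+1] bit strings of length at most [b]. *)
Lemma sketch_scheme vb :
    (#|R| * (M.+2 * #|F| ^ #|J| * 2 ^ b.+1) <= 2 ^ vb)%N ->
  exists V : scheme n, cc_scheme V (M * b) vb.
Proof.
move=> space.
pose state := (('I_M.+2 * {ffun J -> F}) * {bseq b of bool})%type.
pose upd r (st : state) e : state :=
  ((st.1.1, stream_step r st.1.2 e), st.2).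
pose init (r : R) : state := ((ord0, [ffun=> 0]), [bseq]).
pose help r : state -> bool -> state := bit_step t0 T_le (token_step r).
pose answer r (st : state) :=
  if (st.1.1 == M :> nat) && nilp st.2 then out r st.1.2 else None.
have runE r sigma h : let V := Scheme init upd help answer (fun=> [::]) in
    run (V := V) r sigma h =
    let: (w, l) := parse t0 T_le h in
    if (size w == M) && nilp l then out r (sketch r sigma w) else None.
  rewrite /= /run /=.
  have -> : foldl (upd r) (init r) sigma =
      ((ord0, [ffun k => \sum_(e <- sigma) alpha r e k]), [bseq]).
    rewrite /init -[RHS]/((ord0, _), [bseq]).
    have upd_stream f : foldl (upd r) ((ord0, f), [bseq]) sigma =
        ((ord0, foldl (stream_step r) f sigma), [bseq]).
      by elim: sigma f => //= e sigma IH f; rewrite IH.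
    rewrite upd_stream foldl_stream; congr (_, _, _).
    by apply/ffunP => k; rewrite !ffunE add0r.
  rewrite foldl_bit_step //; case: (parse _ _ h) => w l /=.
  rewrite /answer /=.
  have [-> st_sum] := foldl_token_step r [ffun k => \sum_(e <- sigma) alpha r e k] w.
  have -> : (minn (size w) M.+1 == M) = (size w == M) by lia.
  case: eqVneq => [size_w|//] /=; case: ifP => // _.
  congr (out r (fun_of_fin _)); rewrite st_sum ?size_w //; apply/ffunP => k.
  by rewrite !ffunE.
apply: (scheme_with_prover (init := init) (upd := upd) (help := help) (out := answer)) => //.
- apply: leq_trans space; rewrite leq_mul2l !card_prod card_ord card_ffun leq_mul2l.
  apply/orP; right; apply/orP; right; rewrite card_bseq card_bool.
  elim: (b) => [|c IH]; first by rewrite big_ord_recl big_ord0.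
  by rewrite big_ord_recr /= [X in (_ <= X)%N]expnS mul2n -addnn leq_add.
- move=> sigma sigma_ok; have [w size_w w_ok] := complete sigma_ok.
  exists (flatten [seq val (enc T_le x) | x <- w]); first by rewrite size_enc size_w.
  by move=> r; rewrite runE parse_enc // size_w eqxx /= w_ok.
move=> sigma sigma_ok h.
case E : (parse t0 T_le h) => [w l].
apply: leq_trans (sound sigma_ok w); rewrite leq_mul2l /=; apply: subset_leq_card.
apply/subsetP => r; rewrite !inE; have := runE r sigma h; rewrite E /run /= => ->; by case: ifP.
Qed.

End Sketch.

(** * Polynomial identities *)

Section Convolution.
Variables (F : comNzRingType) (I Y : finType) (x : I -> nat) (y : I -> Y) (N : nat).
Variables (a g : I -> F).
Hypothesis x_lt : forall i, x i < N.
Hypothesis xy_inj : injective (fun i => (x i, y i)).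
Local Open Scope ring_scope.

Definition conv : {poly F} :=
  \sum_j (\sum_(i | y i == j) a i *: 'X^(x i)) *
         (\sum_(i | y i == j) g i *: 'X^(N.-1 - x i)).

Lemma horner_conv r : conv.[r] =
  \sum_j (\sum_(i | y i == j) a i * r ^+ x i) *
         (\sum_(i | y i == j) g i * r ^+ (N.-1 - x i)).
Proof.
rewrite horner_sum; apply: eq_bigr => j _; rewrite hornerM !horner_sum.
by congr (_ * _); apply: eq_bigr => i _; rewrite hornerZ hornerXn.
Qed.

Lemma convE : conv =
  \sum_i \sum_(k | y k == y i) (a i * g k) *: 'X^(x i + (N.-1 - x k)).
Proof.
rewrite /conv [RHS](partition_big y xpredT) //=; apply: eq_bigr => j _.
rewrite mulr_suml; apply: eq_bigr => i /eqP->.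
rewrite mulr_sumr; apply: eq_bigr => k _.
by rewrite -scalerAl -scalerAr scalerA exprD.
Qed.

Lemma size_conv : (size conv <= N.*2)%N.
Proof.
rewrite convE; apply: leq_trans (size_sum _ _ _) _; apply/bigmax_leqP => i _.
apply: leq_trans (size_sum _ _ _) _; apply/bigmax_leqP => k _.
apply: leq_trans (size_scale_leq _ _) _; rewrite size_polyXn.
by have := x_lt i; have := x_lt k; lia.
Qed.

(** A product of the terms of i and k has exponent [N.-1] only if [x i = x k]. Both also lie in the
    same class of [y], so [xy_inj] leaves the diagonal. *)
Lemma coef_conv_mid : conv`_N.-1 = \sum_i a i * g i.
Proof.
rewrite convE coef_sum; apply: eq_bigr => i _; rewrite coef_sum (bigD1 i) //=.
rewrite big1 => [|k /andP[/eqP y_eq k_ne]]; rewrite coefZ coefXn.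
  rewrite (_ : _ == _ = true) ?mulr1 ?addr0 //; have := x_lt i; lia.
case: eqP => [x_eq|_]; last by rewrite mulr0.
case/eqP: k_ne; apply: xy_inj; congr (_, _) => //.
by have := x_lt i; have := x_lt k; lia.
Qed.

End Convolution.

Section Layout.
Variables (n t s : nat) (s_gt0 : 0 < s).
Hypotheses (t_gt0 : 0 < t) (ts_n : t * s = n).

Definition slot (v : 'I_n) : 'I_s := Ordinal (ltn_pmod v s_gt0).

Lemma quo_lt (v : 'I_n) : (v %/ s < t)%N.
Proof. by rewrite ltn_divLR // ts_n. Qed.

Lemma pos_lt (e : edge n) : (e.1 * t + e.2 %/ s < n * t)%N.
Proof. by have := quo_lt e.2; have := ltn_ord e.1; nia. Qed.

Lemma pos_slot_inj : injective (fun e : edge n => ((e.1 * t + e.2 %/ s)%N, slot e.2)).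
Proof.
move=> [u v] [u' v'] /= [pos_eq mod_eq].
have u_eq : u = u'.
  apply/val_inj; have := congr1 (fun m => m %/ t)%N pos_eq; rewrite /= !divnMDl //.
  by rewrite !(divn_small (quo_lt _)) !addn0.
move: pos_eq; rewrite u_eq => /addnI quo_eq; congr (_, _); apply/val_inj.
by rewrite /= (divn_eq v s) quo_eq mod_eq -divn_eq.
Qed.

End Layout.

(** * The certificate as two polynomial identities over F_p *)

Section Certificate.
Variables (n t s p : nat) (s_gt0 : 0 < s).
Hypotheses (t_gt0 : 0 < t) (ts_n : t * s = n) (p_pr : prime p).
Hypothesis p_big : 6 * n.+1 ^ 5 < p.
Local Notation F := 'F_p.
Local Notation slot := (slot s_gt0).

Let Fp_nat_inj k l : k < p -> l < p -> (k%:R = l%:R :> F)%R -> k = l.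
Proof.
by move=> k_lt l_lt /(congr1 val) /=; rewrite !val_Fp_nat // !modn_small.
Qed.

Let n_lt_p : n < p.
Proof. by apply: leq_ltn_trans p_big; rewrite !expnS; nia. Qed.

Variables (sigma : seq (edge n)) (par lab dep cnt : 'I_n -> 'I_n) (coef : nat -> F).

Definition num_trees := #|[pred u | par u == u]|.

(** Forcing each root to be its own label makes root labels distinct without a separate check. *)
Definition label u := if par u == u then u else lab u.

(* At most n edges are counted by the first summand, so the factor n + 1 keeps
   one disagreement of labels from making up for missing tree edges. *)
Definition weight u v : nat :=
  (par u == v) && (u != v) + n.+1 * (label u - label v + (label v - label u)) ^ 2.

Local Open Scope ring_scope.

(** The exponents encode pairs of a vertex and a depth. The base is [n.+1] because [(dep u).+1] can
    equal [n]. *)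
Definition forest_poly : {poly F} :=
  \sum_(u | par u != u) 'X^(par u * n.+1 + dep u) -
  \sum_u (cnt u)%:R *: 'X^(u * n.+1 + (dep u).+1).

(* The coefficients of the first sum count at most n < p vertices, so none of
   them vanishes modulo p. *)
Lemma forest_poly_sound : forest_poly = 0 ->
  forall u, par u != u -> dep u = (dep (par u)).+1 :> nat.
Proof.
move=> /eqP; rewrite subr_eq0 => /eqP poly_eq u u_nroot.
have := congr1 (fun q : {poly F} => q`_(par u * n.+1 + dep u)) poly_eq.
rewrite !coef_sum.
under eq_bigr do rewrite coefXn.
under [in RHS]eq_bigr do rewrite coefZ coefXn.
rewrite -natr_sum => coef_eq.
have [v|no_v] := pickP (fun v : 'I_n => par u * n.+1 + dep u == v * n.+1 + (dep v).+1)%N.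
  move/eqP=> uv_eq.
  have par_u : par u = v.
    apply/val_inj; have := congr1 (fun m => m %/ n.+1)%N uv_eq; rewrite /= !divnMDl //.
    by rewrite !divn_small ?addn0 // ltnS ?ltn_ord // ltnW.
  by move: uv_eq; rewrite -par_u => /addnI.
move: coef_eq; rewrite [RHS]big1 => [|v _]; last by rewrite no_v mulr0.
move/(@Fp_nat_inj _ 0%N) => sum0.
have /eqP : (\sum_(i | par i != i) (par u * n.+1 + dep u == par i * n.+1 + dep i))%N = 0%N.
  apply: sum0; last exact: leq_ltn_trans n_lt_p.
  apply: leq_ltn_trans n_lt_p; rewrite -[X in (_ <= X)%N]card_ord -sum1_card.
  by rewrite big_mkcond; apply: leq_sum => i _; case: ifP => // _; case: (_ == _).
by rewrite sum_nat_eq0 => /forall_inP/(_ u u_nroot); rewrite eqxx.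
Qed.

Lemma forest_poly_complete :
    (forall u, par u != u -> dep u = (dep (par u)).+1 :> nat) ->
    (forall v, cnt v = #|[pred u | (par u == v) && (u != v)]| :> nat) ->
  forest_poly = 0.
Proof.
move=> dep_eq cntE; apply/eqP; rewrite subr_eq0; apply/eqP.
rewrite (partition_big par xpredT) //=; apply: eq_bigr => v _.
rewrite cntE -sum1_card natr_sum scaler_suml; apply: eq_big => [u|u].
  by rewrite inE andbC; case: eqP => // ->; rewrite eq_sym.
by case/andP=> u_nroot /eqP <-; rewrite scale1r -dep_eq.
Qed.

Definition adj_poly : {poly F} :=
  conv (fun e : edge n => e.1 * t + e.2 %/ s)%N (fun e => slot e.2) (n * t)
       (fun e => (adj_count sigma e.1 e.2)%:R) (fun e => (weight e.1 e.2)%:R).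

(* The middle coefficient is not taken from the help: it is the number of
   non-roots, the value which the inner product has to take. *)
Definition check_poly : {poly F} :=
  \sum_(i < (n * t).*2 | i != (n * t).-1 :> nat) coef i *: 'X^i +
  (\sum_(u | par u != u) 1)%:R *: 'X^((n * t).-1) - adj_poly.

Lemma coef_adj_poly :
  adj_poly`_(n * t).-1 = (\sum_u \sum_v adj_count sigma u v * weight u v)%N%:R.
Proof.
rewrite coef_conv_mid; [|exact: pos_lt|exact: pos_slot_inj].
rewrite (pair_bigA _ (fun u v => adj_count sigma u v * weight u v)%N) /= natr_sum.
by apply: eq_bigr => e _; rewrite natrM.
Qed.

Lemma coef_check_poly :
  check_poly`_(n * t).-1 = (\sum_(u | par u != u) 1)%:R - adj_poly`_(n * t).-1.
Proof.
rewrite /check_poly coefB coefD coef_sum big1 => [|i i_ne].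
  by rewrite add0r coefZ coefXn eqxx mulr1.
by rewrite coefZ coefXn eq_sym (negPf i_ne) mulr0.
Qed.

Hypothesis sigma_ok : valid_stream sigma.

Let parent_count := (\sum_(u | par u != u) adj_count sigma u (par u))%N.
Let label_count := (\sum_u \sum_v
  adj_count sigma u v * (label u - label v + (label v - label u)) ^ 2)%N.

Let sum_weightE :
  (\sum_u \sum_v adj_count sigma u v * weight u v = parent_count + n.+1 * label_count)%N.
Proof.
rewrite /parent_count /label_count big_distrr.
rewrite [X in _ = (X + _)%N]big_mkcond -big_split /=.
apply: eq_bigr => u _; rewrite big_distrr /= /weight.
under eq_bigr do rewrite mulnDr mulnCA.
rewrite big_split /=; congr (_ + _)%N; rewrite (bigD1 (par u)) //= eqxx /= eq_sym.
rewrite big1 => [|v v_ne]; last by rewrite eq_sym (negPf v_ne) muln0.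
by rewrite addn0; case: eqP; rewrite ?muln1 ?muln0.
Qed.

Lemma check_poly_complete :
    (forall i, (i < (n * t).*2)%N -> coef i = adj_poly`_i) ->
    (forall u, par u != u -> stream_rel sigma u (par u)) ->
    (forall u v, stream_rel sigma u v -> label u = label v) ->
  check_poly = 0.
Proof.
move=> coefE par_adj lab_adj.
have sum_eq : (\sum_u \sum_v adj_count sigma u v * weight u v = \sum_(u | par u != u) 1)%N.
  rewrite sum_weightE [label_count]big1 ?muln0 ?addn0 => [|u _].
    apply: eq_bigr => u /par_adj; rewrite -adj_count_gt0.
    by have := adj_count_le1 u (par u) sigma_ok; lia.
  rewrite big1 // => v _; case: (posnP (adj_count sigma u v)) => [->//|].
  by rewrite adj_count_gt0 => /lab_adj->; rewrite subnn muln0.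
apply/eqP; rewrite subr_eq0; apply/eqP/polyP => i.
have [->|i_ne] := eqVneq i (n * t).-1.
  have := coef_check_poly; rewrite {1}/check_poly coefB coef_adj_poly sum_eq.
  by rewrite subrr => /eqP; rewrite subr_eq0 => /eqP.
rewrite coefD coefZ coefXn (negPf i_ne) mulr0 addr0 coef_sum.
have [i_lt|i_ge] := ltnP i (n * t).*2.
  rewrite (bigD1 (Ordinal i_lt)) //= big1 => [|j /andP[_ j_ne]].
    by rewrite coefZ coefXn eqxx mulr1 addr0 coefE.
  by rewrite coefZ coefXn eq_sym -[i]/(val (Ordinal i_lt)) val_eqE (negPf j_ne) mulr0.
rewrite big1 => [|j _]; last first.
  by rewrite coefZ coefXn gtn_eqF ?mulr0 // (leq_trans (ltn_ord j)).
by rewrite nth_default // (leq_trans _ i_ge) // size_conv //; exact: pos_lt.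
Qed.

(** Both sides of the middle-coefficient identity are below p, so it holds over the naturals. There
    are at most [n] non-roots, so the multiple [n.+1 * label_count] must be zero; then every tree
    edge has to be present to reach the number of non-roots. *)
Lemma check_poly_sound : check_poly = 0 ->
  (forall u, par u != u -> stream_rel sigma u (par u)) /\
  (forall u v, stream_rel sigma u v -> label u = label v).
Proof.
move=> check0; have := coef_check_poly; rewrite check0 coef0 coef_adj_poly.
move=> /esym/eqP; rewrite subr_eq0 sum_weightE => /eqP/Fp_nat_inj sum_eq.
have nroot_le : (\sum_(u | par u != u) 1 <= n)%N.
  by rewrite sum1_card (leq_trans (max_card _)) ?card_ord.
have parent_le : (parent_count <= \sum_(u | par u != u) 1)%N.
  by apply: leq_sum => u _; apply: adj_count_le1.
have label_le : (label_count <= n * (n * n ^ 2))%N.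
  have sum_le (f : 'I_n -> nat) c : (forall u, f u <= c)%N -> (\sum_u f u <= n * c)%N.
    by move=> f_le; rewrite -[X in (X * c)%N]card_ord -sum_nat_const; apply: leq_sum.
  apply: (sum_le) => u; apply: (sum_le) => v.
  rewrite -[X in (_ <= X)%N]mul1n leq_mul ?adj_count_le1 //.
  by rewrite leq_exp2r //; have := ltn_ord (label u); have := ltn_ord (label v); lia.
have {}sum_eq : (\sum_(u | par u != u) 1 = parent_count + n.+1 * label_count)%N.
  apply: sum_eq; first exact: leq_ltn_trans n_lt_p.
  apply: leq_ltn_trans p_big; rewrite !expnS in label_le *; nia.
have label0 : label_count = 0%N by case: label_count sum_eq label_le => // c; nia.
split=> [u u_nroot|u v uv_adj].
  rewrite -adj_count_gt0; move: sum_eq parent_le; rewrite label0 muln0 addn0.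
  rewrite /parent_count (bigD1 u) //= [X in _ = X -> _](bigD1 u) //=.
  case: posnP => // -> others_eq _.
  suff : (1 + \sum_(i | (par i != i) && (i != u)) 1 <=
          \sum_(i | (par i != i) && (i != u)) 1)%N by rewrite add1n ltnn.
  by rewrite others_eq add0n; apply: leq_sum => i _; apply: adj_count_le1.
move/eqP: label0; rewrite sum_nat_eq0 => /forallP/(_ u); rewrite implyTb sum_nat_eq0.
move=> /forallP/(_ v); rewrite implyTb muln_eq0 -leqn0 leqNgt adj_count_gt0 uv_adj /=.
by rewrite expn_eq0 andbT => /eqP ?; apply/val_inj => /=; lia.
Qed.

Lemma certificate_sound :
  forest_poly = 0 -> check_poly = 0 -> num_trees = num_cc sigma.
Proof.
move=> /forest_poly_sound dep_eq /check_poly_sound[par_adj lab_adj].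
apply: (n_comp_certificate (@stream_rel_sym n sigma) (d := dep) (lab := label)) => //.
  by move=> u u_nroot; split; [exact: par_adj | exact: dep_eq].
by move=> u u_root; rewrite /label u_root eqxx.
Qed.

End Certificate.

Lemma eq_adj_poly n t s p (s_gt0 : 0 < s) sigma (par par' lab lab' : 'I_n -> 'I_n) :
  par =1 par' -> lab =1 lab' ->
  adj_poly t p s_gt0 sigma par lab = adj_poly t p s_gt0 sigma par' lab'.
Proof.
move=> eq_par eq_lab; apply: eq_bigr => y _; congr (_ * _)%R; apply: eq_bigr => e _.
by congr (_%:R *: _)%R; rewrite /weight /label !eq_par !eq_lab.
Qed.

(** * The Verifier *)

Section Verifier.
Variables (n t s p : nat) (s_gt0 : 0 < s) (u0 : 'I_n).
Hypotheses (t_gt0 : 0 < t) (ts_n : t * s = n) (p_pr : prime p).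
Hypothesis p_big : 6 * n.+1 ^ 5 < p.
Local Notation F := 'F_p.
Local Notation slot := (@slot n s s_gt0).
Local Open Scope ring_scope.

(* The i-th token holds the parent, label, depth and number of children of
   vertex i (junk for i >= n), and the i-th coefficient of the help polynomial. *)
Definition token : finType := ('I_n * 'I_n * 'I_n * 'I_n * F)%type.
Definition default_token : token := (u0, u0, u0, u0, 0).
Definition tok_par (x : token) := x.1.1.1.1.
Definition tok_lab (x : token) := x.1.1.1.2.
Definition tok_dep (x : token) := x.1.1.2.
Definition tok_cnt (x : token) := x.1.2.
Definition tok_coef (x : token) : F := x.2.

Definition cells : finType := ('I_4 * 'I_s + 'I_6)%type.
(* X^(nt-1-x) = row_pow u * col_pow v at the exponent x of the pair (u, v). *)
Definition row_pow (r : F) (u : 'I_n) := r ^+ ((n.-1 - u) * t).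
Definition col_pow (r : F) (v : 'I_n) := r ^+ (t.-1 - v %/ s).

(* The register (0, y) accumulates A_y(r). The others serve the certificate: for
   each y the contribution of the tree edges to G_y(r) and the first two label
   moments weighted by col_pow, then the label moments weighted by row_pow, the
   number of roots, the depth identity at r, and the help polynomial at r (its
   middle coefficient and the rest apart). *)
Definition edge_update (r : F) (e : edge n) (j : cells) : F :=
  if j is inl (Ordinal 0 _, y) then
    (slot e.2 == y)%:R * r ^+ (e.1 * t + e.2 %/ s) +
    (slot e.1 == y)%:R * r ^+ (e.2 * t + e.1 %/ s)
  else 0.

Definition record_update (r : F) (u : 'I_n) (x : token) (j : cells) : F :=
  let v := tok_par x in
  let l : F := (if v == u then u else tok_lab x)%:R in
  match j with
  | inl (k, y) =>
      [:: 0;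
          (v != u)%:R * (slot v == y)%:R * row_pow r u * col_pow r v;
          (slot u == y)%:R * col_pow r u * l;
          (slot u == y)%:R * col_pow r u * l ^+ 2]`_k
  | inr k =>
      [:: row_pow r u * l;
          row_pow r u * l ^+ 2;
          (v == u)%:R;
          (v != u)%:R * r ^+ (v * n.+1 + tok_dep x) -
            (tok_cnt x)%:R * r ^+ (u * n.+1 + (tok_dep x).+1);
          (v != u)%:R * r ^+ (n * t).-1]`_k
  end.

Definition token_update (r : F) (i : nat) (x : token) (j : cells) : F :=
  if j is inr (Ordinal 5 _) then (i != (n * t).-1)%:R * (tok_coef x * r ^+ i)
  else oapp (fun u => record_update r u x j) 0 (insub i).

Local Notation row_cell k y := (inl (@Ordinal 4 k isT, y) : cells).
Local Notation scalar_cell k := (inr (@Ordinal 6 k isT) : cells).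

Definition answer (r : F) (f : cells -> F) : option nat :=
  let weight_row y :=
    f (row_cell 1 y) + n.+1%:R *
      (f (scalar_cell 1) * (\sum_(v | slot v == y) col_pow r v)
       - 2%:R * f (scalar_cell 0) * f (row_cell 2 y)
       + (\sum_u row_pow r u) * f (row_cell 3 y)) in
  if (f (scalar_cell 3) == 0) &&
     (f (scalar_cell 5) + f (scalar_cell 4)
        - \sum_y f (row_cell 0 y) * weight_row y == 0)
  then Some (val (f (scalar_cell 2))) else None.

Variables (sigma : seq (edge n)) (w : seq token).
Let par (u : 'I_n) := tok_par (nth default_token w u).
Let lab (u : 'I_n) := tok_lab (nth default_token w u).
Let dep (u : 'I_n) := tok_dep (nth default_token w u).
Let cnt (u : 'I_n) := tok_cnt (nth default_token w u).
Let coef (i : nat) := tok_coef (nth default_token w i).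

Let sk r := sketch (n * t).*2 default_token edge_update token_update r sigma w.

Lemma sum_oapp_insub m (f : 'I_n -> F) : (n <= m)%N ->
  \sum_(i < m) oapp f 0 (insub (val i)) = \sum_u f u.
Proof.
move=> n_le; pose g i := oapp f 0 (insub i).
transitivity (\sum_(i < m | (i < n)%N) g i).
  rewrite [RHS]big_mkcond; apply: eq_bigr => i _; rewrite /g.
  by case: insubP => [u -> //|/negbTE ->].
by rewrite -(big_ord_widen _ g) //; apply: eq_bigr => u _; rewrite /g valK.
Qed.

Hypothesis sigma_ok : valid_stream sigma.

(** Each streamed edge is recorded in both orientations. These are distinct pairs since the stream
    has no loops, so nothing is counted twice. *)
Lemma sum_adj_count (y : 'I_s) (h : edge n -> F) :
  \sum_(e <- sigma) ((slot e.2 == y)%:R * h e + (slot e.1 == y)%:R * h (e.2, e.1)) =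
  \sum_(e | slot e.2 == y) (adj_count sigma e.1 e.2)%:R * h e.
Proof.
have [/allP loopless _] := andP sigma_ok.
have {loopless} : {in sigma, forall e, e.1 != e.2} by [].
elim: sigma => [|x l IH] loopless.
  by rewrite big_nil big1 // => e _; rewrite mul0r.
rewrite big_cons IH => [|e e_in]; last by apply: loopless; rewrite inE e_in orbT.
have x_loopless := loopless x (mem_head _ _).
rewrite [RHS](eq_bigr (fun e => (e == x)%:R * h e + (e == (x.2, x.1))%:R * h e +
    (adj_count l e.1 e.2)%:R * h e)); last first.
  move=> [u v] _; rewrite -!mulrDl -!natrD; congr (_%:R * _); rewrite /adj_count /=.
  congr (_ + _)%N; case: x x_loopless {loopless} => a b /= ab.
  have -> : ((a, b) == (v, u)) = ((u, v) == (b, a)).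
    by rewrite !xpair_eqE andbC [b == u]eq_sym [a == v]eq_sym.
  rewrite [(a, b) == _]eq_sym; have [[-> ->]|//] := eqVneq (u, v) (a, b).
  by rewrite xpair_eqE (negPf ab).
rewrite !big_split /=; congr (_ + _ + _).
  rewrite big_mkcond (bigD1 x) //= eqxx mul1r big1 ?addr0 => [|e /negPf->].
    by case: ifP; rewrite ?mul1r ?mul0r.
  by rewrite mul0r if_same.
rewrite big_mkcond (bigD1 (x.2, x.1)) //= eqxx mul1r big1 ?addr0 => [|e /negPf->].
  by case: ifP; rewrite ?mul1r ?mul0r.
by rewrite mul0r if_same.
Qed.

Let n_gt0 : (0 < n)%N.
Proof. exact: leq_ltn_trans (ltn_ord u0). Qed.

Let n_le : (n <= (n * t).*2)%N.
Proof. by nia. Qed.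

Lemma sum_record_update r j :
  \sum_(i < (n * t).*2)
     oapp (fun u => record_update r u (nth default_token w i) j) 0 (insub (val i)) =
  \sum_u record_update r u (nth default_token w u) j.
Proof.
rewrite -(sum_oapp_insub _ n_le); apply: eq_bigr => i _.
by case: insubP => [u _ /= ->|].
Qed.

Let sk_edges r y : sk r (row_cell 0 y) =
  \sum_(e | slot e.2 == y) (adj_count sigma e.1 e.2)%:R * r ^+ (e.1 * t + e.2 %/ s).
Proof.
rewrite ffunE /= (sum_record_update r (row_cell 0 y)) [X in _ + X]big1 // addr0.
exact: (sum_adj_count y (fun e => r ^+ (e.1 * t + e.2 %/ s))).
Qed.

Let sk_records r (j : cells) :
    (forall e, edge_update r e j = 0) ->
    (forall i x, token_update r i x j = oapp (fun u => record_update r u x j) 0 (insub i)) ->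
  sk r j = \sum_u record_update r u (nth default_token w u) j.
Proof.
move=> no_edge tokE; rewrite ffunE big1 ?add0r => [|e _]; last exact: no_edge.
by rewrite -sum_record_update; apply: eq_bigr => i _; apply: tokE.
Qed.

Lemma horner_forest_poly r :
  (forest_poly p par dep cnt).[r] = sk r (scalar_cell 3).
Proof.
rewrite sk_records // /= hornerD hornerN !horner_sum.
rewrite big_mkcond -sumrB; apply: eq_bigr => u _ /=.
rewrite hornerZ hornerXn; congr (_ - _); case: ifP => _.
  by rewrite hornerXn mul1r.
by rewrite mul0r.
Qed.

Let num_treesE r : val (sk r (scalar_cell 2)) = num_trees par.
Proof.
rewrite sk_records // /= -natr_sum val_Fp_nat //.
have -> : (\sum_(u : 'I_n) nat_of_bool (tok_par (nth default_token w u) == u) = num_trees par)%N.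
  by rewrite /num_trees -sum1_card [RHS]big_mkcond; apply: eq_bigr => u _; rewrite inE; case: eqP.
rewrite modn_small //; apply: leq_ltn_trans (max_card _) _; rewrite card_ord.
by apply: leq_ltn_trans p_big; rewrite !expnS; nia.
Qed.

Lemma natr_weight u v : (weight par lab u v)%:R =
  ((par u == v) && (u != v))%:R +
  n.+1%:R * ((label par lab u)%:R - (label par lab v)%:R) ^+ 2 :> F.
Proof.
rewrite natrD natrM; congr (_ + _ * _); rewrite natrX.
have [le|lt] := leqP (label par lab u) (label par lab v).
  by rewrite (eqP le) add0n natrB // -sqrrN opprB.
by rewrite natrD natrB ?(ltnW lt) // (eqP (ltnW lt)) addr0.
Qed.

Let posE (u v : 'I_n) :
  ((n * t).-1 - (u * t + v %/ s) = (n.-1 - u) * t + (t.-1 - v %/ s))%N.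
Proof.
have q_lt := quo_lt s_gt0 ts_n v.
have -> : ((n * t).-1 = n.-1 * t + t.-1)%N.
  by rewrite -[in LHS](prednK n_gt0) mulSn; lia.
have [d ->] : exists d, n.-1 = (u + d)%N by exists (n.-1 - u)%N; have := ltn_ord u; lia.
by rewrite addKn mulnDl; lia.
Qed.

(** Expanding the squared label difference as [L u ^+ 2 - 2 L u L v + L v ^+ 2] separates u from v.
    With the splitting of the exponent, the double sum becomes products of single-vertex sums, which
    are registers or known to the Verifier. *)
Lemma sum_weight r y :
  \sum_(e | slot e.2 == y) (weight par lab e.1 e.2)%:R *
      r ^+ ((n * t).-1 - (e.1 * t + e.2 %/ s)) =
  sk r (row_cell 1 y) + n.+1%:R *
    (sk r (scalar_cell 1) * (\sum_(v | slot v == y) col_pow r v)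
     - 2%:R * sk r (scalar_cell 0) * sk r (row_cell 2 y)
     + (\sum_u row_pow r u) * sk r (row_cell 3 y)).
Proof.
pose L u : F := (label par lab u)%:R.
have filtered (c : 'I_n -> F) :
    \sum_v (slot v == y)%:R * col_pow r v * c v = \sum_(v | slot v == y) col_pow r v * c v.
  by rewrite [RHS]big_mkcond; apply: eq_bigr => v _; case: eqP; rewrite ?mul1r // !mul0r.
rewrite !sk_records //= (filtered L) (filtered (fun v => L v ^+ 2)).
transitivity (\sum_u \sum_(v | slot v == y)
    (weight par lab u v)%:R * (row_pow r u * col_pow r v)).
  rewrite pair_big /=; apply: eq_bigr => [[u v] _] /=.
  by rewrite posE exprD.
rewrite !big_distrlr /= [2%:R * _]mulr_sumr [X in _ - X]big_distrlr /=.
rewrite -sumrB -big_split mulr_sumr -big_split /=; apply: eq_bigr => u _.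
rewrite -sumrB -big_split mulr_sumr /=.
(* The tree-edge part needs no separation: for fixed [u] only [v = par u] contributes. *)
have -> : (tok_par (nth default_token w u) != u)%:R *
    (slot (tok_par (nth default_token w u)) == y)%:R * row_pow r u *
    col_pow r (tok_par (nth default_token w u)) =
    \sum_(v | slot v == y) ((par u == v) && (u != v))%:R * (row_pow r u * col_pow r v).
  rewrite -/(par u) big_mkcond (bigD1 (par u)) //= big1 => [|v v_ne].
    rewrite eqxx [u == _]eq_sym addr0 /=.
    by case: (par u != u); case: (slot _ == y); rewrite ?mul1r ?mul0r.
  by rewrite [par u == v]eq_sym (negPf v_ne) mul0r if_same.
rewrite -big_split; apply: eq_bigr => v _ /=.
by rewrite natr_weight -/(L u) -/(L v); ring.
Qed.

Lemma horner_check_poly r :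
  (check_poly t s_gt0 sigma par lab coef).[r] =
  sk r (scalar_cell 5) + sk r (scalar_cell 4) -
  \sum_y sk r (row_cell 0 y) * (sk r (row_cell 1 y) + n.+1%:R *
    (sk r (scalar_cell 1) * (\sum_(v | slot v == y) col_pow r v)
     - 2%:R * sk r (scalar_cell 0) * sk r (row_cell 2 y)
     + (\sum_u row_pow r u) * sk r (row_cell 3 y))).
Proof.
rewrite /check_poly hornerD hornerN hornerD; congr (_ + _ - _).
- rewrite ffunE [X in _ = X + _]big1 ?add0r // horner_sum big_mkcond; apply: eq_bigr => i _ /=.
  by case: eqP => _; rewrite ?mul0r // mul1r hornerZ hornerXn.
- rewrite hornerZ hornerXn sk_records //= -mulr_suml; congr (_ * _).
  by rewrite -natr_sum [in LHS]big_mkcond.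
rewrite horner_conv; apply: eq_bigr => y _.
by rewrite sk_edges -sum_weight.
Qed.

Lemma answerE r : answer r (sk r) =
  if ((forest_poly p par dep cnt).[r] == 0) &&
     ((check_poly t s_gt0 sigma par lab coef).[r] == 0)
  then Some (num_trees par) else None.
Proof. by rewrite /answer horner_forest_poly horner_check_poly num_treesE. Qed.

End Verifier.

(** * Completeness and soundness *)

Lemma card_roots_lt (K : finFieldType) (P : {poly K}) :
  P != 0%R -> #|[pred r | P.[r]%R == 0%R]| < size P.
Proof.
move=> P_neq0; rewrite cardE; apply: max_poly_roots => //; last exact: enum_uniq.
by apply/allP => r; rewrite mem_enum.
Qed.

Section Protocol.
Variables (n t s p : nat) (s_gt0 : 0 < s) (u0 : 'I_n).
Hypotheses (t_gt0 : 0 < t) (ts_n : t * s = n) (p_pr : prime p).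
Hypothesis p_big : 6 * n.+1 ^ 5 < p.
Local Notation F := 'F_p.
Variable sigma : seq (edge n).
Hypothesis sigma_ok : valid_stream sigma.

Let result (r : F) w := answer n t s_gt0 r
  (sketch (n * t).*2 (default_token p u0) (edge_update t s_gt0) (token_update t s_gt0)
     r sigma w).

Lemma size_forest_poly (par dep cnt : 'I_n -> 'I_n) :
  size (forest_poly p par dep cnt) <= n * n.+1.
Proof.
apply: leq_trans (size_polyD _ _) _; rewrite size_polyN geq_max; apply/andP; split.
  apply: leq_trans (size_sum _ _ _) _; apply/bigmax_leqP => u _; rewrite size_polyXn.
  by have := ltn_ord (par u); have := ltn_ord (dep u); nia.
apply: leq_trans (size_sum _ _ _) _; apply/bigmax_leqP => u _.
apply: leq_trans (size_scale_leq _ _) _; rewrite size_polyXn.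
by have := ltn_ord u; have := ltn_ord (dep u); nia.
Qed.

Lemma size_check_poly par lab (coef : nat -> F) :
  size (check_poly t s_gt0 sigma par lab coef) <= (n * t).*2.
Proof.
have nt_gt0 : 0 < n * t by rewrite muln_gt0 t_gt0 (leq_ltn_trans _ (ltn_ord u0)).
apply: leq_trans (size_polyD _ _) _; rewrite size_polyN geq_max; apply/andP; split.
  apply: leq_trans (size_polyD _ _) _; rewrite geq_max; apply/andP; split.
    apply: leq_trans (size_sum _ _ _) _; apply/bigmax_leqP => i _.
    by apply: leq_trans (size_scale_leq _ _) _; rewrite size_polyXn.
  by apply: leq_trans (size_scale_leq _ _) _; rewrite size_polyXn; lia.
by apply: size_conv => e; apply: pos_lt.
Qed.

(** If both polynomials vanish, the certificate is right and so is any output. Otherwise a wrong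
    output needs r to be a root of a nonzero polynomial of size at most p / 3. *)
Lemma protocol_sound w :
  3 * #|[pred r | match result r w with
                  | Some x => x != num_cc sigma
                  | None => false end]| <= #|F|.
Proof.
pose tok i := nth (default_token p u0) w i.
pose fp := forest_poly p (fun u : 'I_n => tok_par (tok u)) (fun u => tok_dep (tok u))
  (fun u => tok_cnt (tok u)).
pose cp := check_poly t s_gt0 sigma (fun u : 'I_n => tok_par (tok u))
  (fun u => tok_lab (tok u)) (fun i => tok_coef (tok i)).
have resultE r : result r w = if (fp.[r]%R == 0%R) && (cp.[r]%R == 0%R)
    then Some (num_trees (fun u : 'I_n => tok_par (tok u))) else None.
  by rewrite /result answerE.
have by_roots (P : {poly F}) : P != 0%R -> 3 * size P <= p ->
    (forall r, isSome (result r w) -> P.[r]%R == 0%R) ->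
    3 * #|[pred r | match result r w with
                  | Some x => x != num_cc sigma
                  | None => false end]| <= #|F|.
  move=> P_neq0 size_le P_root; rewrite card_Fp //; apply: leq_trans size_le.
  rewrite leq_mul2l /=; apply: leq_trans (ltnW (card_roots_lt P_neq0)).
  apply/subset_leq_card/subsetP => r; rewrite !inE => bad; apply: P_root.
  by move: bad; case: (result r w).
have t_le : t <= n by rewrite -ts_n leq_pmulr.
have [fp0|fp_neq0] := eqVneq fp 0%R; last first.
  apply: (by_roots fp) => // [|r]; last by rewrite resultE; case: ifP => // /andP[].
  have := size_forest_poly (fun u : 'I_n => tok_par (tok u)) (fun u => tok_dep (tok u))
    (fun u => tok_cnt (tok u)).
  by rewrite -/fp; move: (size fp) p_big => m; rewrite !expnS; nia.
have [cp0|cp_neq0] := eqVneq cp 0%R; last first.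
  apply: (by_roots cp) => // [|r]; last by rewrite resultE; case: ifP => // /andP[].
  have := size_check_poly (fun u : 'I_n => tok_par (tok u))
    (fun u => tok_lab (tok u)) (fun i => tok_coef (tok i)).
  by rewrite -/cp; move: (size cp) p_big => m; rewrite !expnS; nia.
rewrite eq_card0 ?muln0 // => r; rewrite !inE resultE.
case: ifP => // _; apply/negbTE/negPn/eqP.
exact: certificate_sound fp0 cp0.
Qed.

Lemma protocol_complete :
  exists2 w, size w = (n * t).*2 & forall r, result r w = Some (num_cc sigma).
Proof.
have [par [dep [forest par_root dep_lt]]] := ex_spanning_forest (@stream_rel_sym n sigma).
rewrite card_ord in dep_lt.
(* No vertex is its own child, so the number of children fits in ['I_n]. *)
have cnt_lt v : #|[pred u | (par u == v) && (u != v)]| < n.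
  rewrite -[X in _ < X]card_ord; apply: proper_card; apply/properP.
  split; first exact/subsetP.
  by exists v; rewrite // !inE eqxx andbF.
pose lab u := fingraph.root (stream_rel sigma) u.
pose coef i : F := ((adj_poly t p s_gt0 sigma par lab)`_i)%R.
pose token_of i : token n p := let u := odflt u0 (insub i) in
  (par u, lab u, Ordinal (dep_lt u), Ordinal (cnt_lt u), coef i).
exists (mkseq token_of (n * t).*2) => [|r]; first by rewrite size_mkseq.
pose tok i := nth (default_token p u0) (mkseq token_of (n * t).*2) i.
have tokE (u : 'I_n) :
    tok u = (par u, lab u, Ordinal (dep_lt u), Ordinal (cnt_lt u), coef u).
  rewrite /tok nth_mkseq /token_of ?valK //.
  by apply: leq_trans (ltn_ord u) _; rewrite -addnn; nia.
have parE : par =1 fun u : 'I_n => tok_par (tok u) by move=> u; rewrite tokE.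
have labE : lab =1 fun u : 'I_n => tok_lab (tok u) by move=> u; rewrite tokE.
(* Roots of the forest are canonical representatives, so the override in [label] changes nothing. *)
have label_root (u : 'I_n) :
    label (fun u : 'I_n => tok_par (tok u)) (fun u => tok_lab (tok u)) u = lab u.
  by rewrite /label -parE -labE; case: eqP => // /par_root.
have fp0 : forest_poly p (fun u : 'I_n => tok_par (tok u)) (fun u => tok_dep (tok u))
    (fun u => tok_cnt (tok u)) = 0%R.
  apply: forest_poly_complete => [u|v]; first by rewrite -parE !tokE => /forest[].
  by rewrite tokE /=; apply: eq_card => u; rewrite !inE -parE.
have cp0 : check_poly t s_gt0 sigma (fun u : 'I_n => tok_par (tok u))
    (fun u => tok_lab (tok u)) (fun i => tok_coef (tok i)) = 0%R.
  apply: check_poly_complete => // [i i_lt|u|u v uv_adj].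
  - by rewrite -(eq_adj_poly _ _ _ _ parE labE) /tok nth_mkseq.
  - by rewrite -parE => /forest[].
  rewrite !label_root; apply/(fingraph.rootP (sym_connect_sym (@stream_rel_sym n sigma))).
  exact: connect1.
by rewrite /result answerE // fp0 cp0 !horner0 eqxx (certificate_sound _ _ _ _ _ fp0 cp0).
Qed.

End Protocol.

Lemma component_scheme n t s p b vb (u0 : 'I_n) :
    0 < t -> t * s = n -> prime p -> 6 * n.+1 ^ 5 < p ->
    0 < b -> n ^ 4 * p <= 2 ^ b ->
    p * ((n * t).*2.+2 * p ^ (4 * s + 6) * 2 ^ b.+1) <= 2 ^ vb ->
  exists V : scheme n, cc_scheme V ((n * t).*2 * b) vb.
Proof.
move=> t_gt0 ts_n p_pr p_big b_gt0 tok_le space.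
have /andP[_ s_gt0] : (0 < t) && (0 < s).
  by rewrite -muln_gt0 ts_n (leq_ltn_trans _ (ltn_ord u0)).
apply: (sketch_scheme (R := 'F_p) (J := cells s) (F := 'F_p) (T := token n p)
  (t0 := default_token p u0) (alpha := edge_update t s_gt0)
  (beta := token_update t s_gt0) (out := answer n t s_gt0)) => //.
- by rewrite card_Fp // prime_gt0.
- rewrite -[#|_|]/#|{: 'I_n * 'I_n * 'I_n * 'I_n * 'F_p}| !card_prod card_Fp // !card_ord.
  by apply: leq_trans tok_le; rewrite !expnS expn0 muln1 !mulnA.
- by move=> sigma sigma_ok; apply: protocol_complete.
- by move=> sigma sigma_ok w; apply: protocol_sound.
by rewrite -[#|cells s|]/#|{: 'I_4 * 'I_s + 'I_6}| card_sum card_prod card_Fp // !card_ord.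
Qed.

Theorem theorem4p10 :
  exists (C k : nat), forall n t s : nat, 0 < t -> 0 < s -> t * s = n ->
    exists V : scheme n,
      cc_scheme V (C * (n * t) * lg n ^ k) (C * s * lg n ^ k).
Proof.
exists 300, 1 => n t s t_gt0 s_gt0 ts_n; rewrite expn1; set L := lg n.
have L_gt0 : 0 < L by [].
have n_gt0 : 0 < n by rewrite -ts_n muln_gt0 t_gt0.
have n_lt : n < 2 ^ L by apply: trunc_log_ltn.
have t_le : t <= n by rewrite -ts_n leq_pmulr.
(* Chosen so that [6 * n.+1 ^ 5 <= 2 ^ 3 * (2 ^ L) ^ 5]. Then p has at most
   [2a + 3 = 10 L + 9 <= 19 L] bits, and a token, with four vertices and one field element, takes
   [4 L + 19 L] bits. *)
pose a := 5 * L + 3.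
have [p p_pr /andP[p_gt p_le]] := prime_between_exp2 a.
have p_big : 6 * n.+1 ^ 5 < p.
  apply: leq_ltn_trans p_gt; rewrite /a expnD [5 * L]mulnC expnM mulnC.
  by apply: leq_mul; rewrite // leq_exp2r.
have {}p_le : p <= 2 ^ (19 * L).
  by apply: leq_trans p_le _; rewrite leq_exp2l // /a; lia.
pose b := 23 * L.
have tok_le : n ^ 4 * p <= 2 ^ b.
  rewrite /b (_ : 23 * L = L * 4 + 19 * L); last by lia.
  by rewrite expnD leq_mul // expnM leq_exp2r // ltnW.
have count_le : (n * t).*2.+2 <= 2 ^ (2 * L + 2).
  have -> : 2 * L + 2 = L + L + 2 by lia.
  rewrite !expnD -addnn; move: (2 ^ L) n_lt => m; nia.
have space : p * ((n * t).*2.+2 * p ^ (4 * s + 6) * 2 ^ b.+1) <= 2 ^ (300 * s * L).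
  apply: (@leq_trans (2 ^ (19 * L + (2 * L + 2 + 19 * L * (4 * s + 6) + b.+1)))).
    have pow_le : p ^ (4 * s + 6) <= 2 ^ (19 * L * (4 * s + 6)).
      by rewrite [X in _ <= X]expnM leq_exp2r ?addn_gt0 ?orbT.
    rewrite [X in _ <= X]expnD leq_mul // [X in _ <= X]expnD leq_mul //.
    by rewrite [X in _ <= X]expnD leq_mul.
  (* The exponent is [76 s L + 158 L + 3], at most [237 s L]. *)
  by rewrite leq_exp2l // /b; nia.
have [|V [? ? V_size ? ?]] := component_scheme (Ordinal n_gt0) t_gt0 ts_n p_pr p_big _ tok_le space.
  by rewrite muln_gt0.
exists V; split=> // sigma /V_size size_le; apply: leq_trans size_le _.
by rewrite /b -addnn; nia.
Qed.
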